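(* Let $n\ge 2$, and let $B(c_i,r_i)\subset\mathbb{R}^{n-1}$, $i=1,\dots,m$ ($m\ge 1$), be closed Euclidean balls with centers $c_i\in\mathbb{R}^{n-1}$ and radii $r_i\ge 0$. Let $\mathcal{P}=\{(-r_i;c_i): i=1,\dots,m\}\subset\mathbb{R}^n$ and let $x^*=(x_0^*;\bar x^* )$ be the optimal solution of $Inf_{\mathcal{Q}}(\mathcal{P})$. Then the ball of smallest radius that contains all the balls $B(c_i,r_i)$, $i=1,\dots,m$, is the ball with center $\bar x^*$ and radius $-x_0^*$.
   Context: Vectors of $\mathbb{R}^n$ are written $x=(x_0;\bar x)$ with $x_0\in\mathbb{R}$, $\bar x\in\mathbb{R}^{n-1}$. The second-order cone is $\mathcal{Q}=\{x\in\mathbb{R}^n:\ \|\bar x\|_2\le x_0\}$, and $x\preceq_{\mathcal{Q}} p$ means $p-x\in\mathcal{Q}$, i.e. $\|\bar p-\bar x\|\le p_0-x_0$. For a finite nonempty set $\mathcal{P}=\{p_1,\dots,p_m\}\subset\mathbb{R}^n$, $Inf_{\mathcal{Q}}(\mathcal{P})$ is the problem: maximize $x_0$ subject to $x\preceq_{\mathcal{Q}}p_i$ for $i=1,\dots,m$. Its optimal solution exists and is unique. $B(c,r)$ is the closed Euclidean ball in $\mathbb{R}^{n-1}$ with center $c$ and radius $r\ge0$. *)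

(* Defs.v *)
From HB Require Import structures.
From mathcomp Require Import all_boot all_order all_algebra.
From mathcomp Require Import all_classical all_reals.

Set Implicit Arguments.
Unset Strict Implicit.
Unset Printing Implicit Defensive.

Import Order.TTheory GRing.Theory Num.Theory.
Local Open Scope classical_set_scope.
Local Open Scope ring_scope.

(* R^n is represented as 'rV[R]_(1 + d) with n = 1 + d, so that x = (x_0; \bar x)
   is the library's block decomposition of a row. *)

Definition pt_head (R : realType) (d : nat) (x : 'rV[R]_(1 + d)) : R :=
  lsubmx x 0 0.

Definition pt_bar (R : realType) (d : nat) (x : 'rV[R]_(1 + d)) : 'rV[R]_d :=
  rsubmx x.

Definition pt (R : realType) (d : nat) (x0 : R) (xb : 'rV[R]_d) :
    'rV[R]_(1 + d) :=
  row_mx (const_mx x0) xb.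

(* Not the norm `|x| of MathComp-Analysis, which is the sup norm on matrices. *)
Definition norm2 (R : realType) (d : nat) (x : 'rV[R]_d) : R :=
  Num.sqrt (\sum_(i < d) x 0 i ^+ 2).

Definition soc (R : realType) (d : nat) : set 'rV[R]_(1 + d) :=
  [set x | norm2 (pt_bar x) <= pt_head x].

Definition soc_le (R : realType) (d : nat) (x p : 'rV[R]_(1 + d)) : Prop :=
  soc (p - x).

Definition InfQ_feasible (R : realType) (d : nat)
    (P : set 'rV[R]_(1 + d)) (x : 'rV[R]_(1 + d)) : Prop :=
  forall p, P p -> soc_le x p.

Definition InfQ_optimal (R : realType) (d : nat)
    (P : set 'rV[R]_(1 + d)) (x : 'rV[R]_(1 + d)) : Prop :=
  InfQ_feasible P x /\
  forall y, InfQ_feasible P y -> pt_head y <= pt_head x.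

Definition eball (R : realType) (d : nat) (c : 'rV[R]_d) (r : R) :
    set 'rV[R]_d :=
  [set y | norm2 (y - c) <= r].

Definition encloses (R : realType) (d m : nat)
    (c : 'I_m -> 'rV[R]_d) (r : 'I_m -> R) (z : 'rV[R]_d) (s : R) : Prop :=
  0 <= s /\ forall i, eball (c i) (r i) `<=` eball z s.

Definition smallest_enclosing_ball (R : realType) (d m : nat)
    (c : 'I_m -> 'rV[R]_d) (r : 'I_m -> R) (z : 'rV[R]_d) (s : R) : Prop :=
  encloses c r z s /\
  forall (z' : 'rV[R]_d) (s' : R), encloses c r z' s' -> s <= s'.

(* Main.v *)
Require Import Defs.
From mathcomp Require Import all_boot all_order all_algebra.
From mathcomp Require Import all_classical all_reals.
From mathcomp Require Import ring lra.

Set Implicit Arguments.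
Unset Strict Implicit.
Unset Printing Implicit Defensive.

Import Order.TTheory GRing.Theory Num.Theory.
Local Open Scope classical_set_scope.
Local Open Scope ring_scope.

(** A ball B(c, r) lies in B(z, s) exactly when |c - z| + r <= s
    ([eball_subset]): the triangle inequality gives one direction, and the point
    of B(c, r) farthest from z, at distance |c - z| + r from it, gives the other.
    The inequality |c - z| <= - r - (- s) is also what it means for (- s; z) to be
    below (- r; c) in the order of the cone. Thus enclosing balls of radius s
    centred at z are the same as feasible points (- s; z) ([encloses_feasible]),
    and minimizing the radius s is maximizing the head - s.

    The smallest enclosing ball is unique because the Euclidean norm is strictly
    convex: if two different centres served for the same radius, then by the
    parallelogram law their midpoint would serve for a smaller one
    ([encloses_midpoint]). *)

Section EuclideanNorm.
Variables (R : realType) (d : nat).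
Implicit Types (u v : 'rV[R]_d) (a b : R).

Lemma norm2_ge0 u : 0 <= norm2 u.
Proof. exact: sqrtr_ge0. Qed.

Lemma sqr_norm2 u : norm2 u ^+ 2 = \sum_(i < d) u 0 i ^+ 2.
Proof. by rewrite sqr_sqrtr // sumr_ge0 // => i _; apply: sqr_ge0. Qed.

Lemma norm2_eq0 u : (norm2 u == 0) = (u == 0).
Proof.
rewrite -sqrf_eq0 sqr_norm2 psumr_eq0 => [|i _]; last exact: sqr_ge0.
apply/allP/eqP => [u0|-> i _]; last by rewrite /= mxE expr0n eqxx.
apply/rowP => i; rewrite mxE; apply/eqP.
by have := u0 i (mem_index_enum i); rewrite sqrf_eq0.
Qed.

Lemma norm2Z a u : norm2 (a *: u) = `|a| * norm2 u.
Proof.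
rewrite -sqrtr_sqr -sqrtrM ?sqr_ge0 // mulr_sumr; congr Num.sqrt.
by apply: eq_bigr => i _; rewrite mxE exprMn.
Qed.

Lemma norm2_delta i : norm2 (delta_mx 0 i : 'rV[R]_d) = 1.
Proof.
rewrite /norm2 (bigD1 i) //= big1 => [|j ji]; rewrite mxE ?eqxx.
  by rewrite expr1n addr0 sqrtr1.
by rewrite (negbTE ji) expr0n.
Qed.

Lemma sqr_norm2_comb a b u v :
  norm2 (a *: u + b *: v) ^+ 2 =
  a ^+ 2 * norm2 u ^+ 2 + 2 * a * b * (\sum_(i < d) u 0 i * v 0 i)
  + b ^+ 2 * norm2 v ^+ 2.
Proof.
rewrite !sqr_norm2 !mulr_sumr -!big_split /=.
by apply: eq_bigr => i _; rewrite !mxE; ring.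
Qed.

Lemma cauchy_schwarz u v :
  \sum_(i < d) u 0 i * v 0 i <= norm2 u * norm2 v.
Proof.
have [u0|uN0] := eqVneq (norm2 u) 0.
  move/eqP: (u0); rewrite norm2_eq0 => /eqP ->.
  rewrite big1 ?mulr_ge0 ?norm2_ge0 // => i _.
  by rewrite mxE mul0r.
have [v0|vN0] := eqVneq (norm2 v) 0.
  move/eqP: (v0); rewrite norm2_eq0 => /eqP ->.
  rewrite big1 ?mulr_ge0 ?norm2_ge0 // => i _.
  by rewrite mxE mulr0.
(* The square of | |v| u - |u| v | is 2 |u| |v| (|u| |v| - <u, v>). *)
have := sqr_ge0 (norm2 (norm2 v *: u + (- norm2 u) *: v)).
rewrite sqr_norm2_comb => h.
have uv0 : 0 < 2 * (norm2 u * norm2 v).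
  by rewrite !mulr_gt0 // lt0r ?uN0 ?vN0 norm2_ge0.
rewrite -subr_ge0 -(pmulr_rge0 _ uv0); lra.
Qed.

Lemma ler_norm2D u v : norm2 (u + v) <= norm2 u + norm2 v.
Proof.
have uv0 : 0 <= norm2 u + norm2 v by rewrite addr_ge0 ?norm2_ge0.
rewrite -(ler_pXn2r (n := 2)) ?nnegrE ?norm2_ge0 //.
have := sqr_norm2_comb 1 1 u v; rewrite !scale1r => ->.
have := cauchy_schwarz u v; lra.
Qed.

Lemma parallelogram_midpoint u v :
  norm2 (2^-1 *: (u + v)) ^+ 2 =
  (norm2 u ^+ 2 + norm2 v ^+ 2) / 2 - norm2 (u - v) ^+ 2 / 4.
Proof.
have := sqr_norm2_comb 2^-1 2^-1 u v.
have := sqr_norm2_comb 1 (-1) u v.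
by rewrite scalerDr scale1r scaleN1r => -> ->; field.
Qed.

End EuclideanNorm.

(** The dimension has to be positive: a point at distance r from the centre must
    exist even when the two centres coincide. *)
Lemma eball_subset (R : realType) (d : nat) (c z : 'rV[R]_d) (r s : R) :
  (0 < d)%N -> 0 <= r ->
  eball c r `<=` eball z s <-> norm2 (c - z) + r <= s.
Proof.
move=> d0 r0; split=> [sub|le_s y]; last first.
  rewrite /eball /= => yc.
  have -> : y - z = (y - c) + (c - z) by rewrite addrA subrK.
  apply: le_trans (ler_norm2D _ _) _.
  by rewrite addrC; apply: le_trans le_s; rewrite lerD2l.
(* A unit vector e pointing from z to c, arbitrary if c = z. *)
have [e e1 cze] : exists2 e : 'rV[R]_d, norm2 e = 1 & c - z = norm2 (c - z) *: e.
  have [cz|czN0] := eqVneq (c - z) 0.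
    exists (delta_mx 0 (Ordinal d0)); first exact: norm2_delta.
    have /eqP -> : norm2 (c - z) == 0 by rewrite norm2_eq0 cz.
    by rewrite scale0r.
  have nN0 : norm2 (c - z) != 0 by rewrite norm2_eq0.
  exists ((norm2 (c - z))^-1 *: (c - z)).
    by rewrite norm2Z ger0_norm ?invr_ge0 ?norm2_ge0 // mulVf.
  by rewrite scalerA mulfV // scale1r.
have /sub : eball c r (c + r *: e).
  by rewrite /eball /= addrC addKr norm2Z e1 mulr1 ger0_norm.
rewrite /eball /=.
have -> : c + r *: e - z = (norm2 (c - z) + r) *: e.
  by rewrite addrAC scalerDl -cze.
by rewrite norm2Z e1 mulr1 ger0_norm // addr_ge0 ?norm2_ge0.
Qed.

Section EnclosingBalls.
Variables (R : realType) (d m : nat) (c : 'I_m -> 'rV[R]_d) (r : 'I_m -> R).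
Hypotheses (d_gt0 : (0 < d)%N) (m_gt0 : (0 < m)%N) (r_ge0 : forall i, 0 <= r i).

(** The radius is nonnegative as soon as one ball is enclosed. *)
Lemma enclosesP z s :
  encloses c r z s <-> forall i, norm2 (c i - z) + r i <= s.
Proof.
split=> [[_ sub] i|le_s]; first exact/eball_subset.
split=> [|i]; last exact/eball_subset.
by apply: le_trans (le_s (Ordinal m_gt0)); rewrite addr_ge0 ?norm2_ge0.
Qed.

Lemma encloses_feasible (x : 'rV[R]_(1 + d)) :
  encloses c r (pt_bar x) (- pt_head x) <->
  InfQ_feasible [set pt (- r i) (c i) | i in [set: 'I_m]] x.
Proof.
have leE i : soc_le x (pt (- r i) (c i)) =
    (norm2 (c i - pt_bar x) + r i <= - pt_head x) :> Prop.
  rewrite /soc_le /soc /= /pt_bar /pt_head !linearB /= row_mxKl row_mxKr !mxE.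
  by congr is_true; apply/idP/idP => h; lra.
rewrite enclosesP; split=> [le_x _ [i _ <-]|fx i]; first by rewrite leE.
by rewrite -leE; apply: fx; exists i.
Qed.

(** The midpoint w satisfies |c_i - w|^2 <= (s - r_i)^2 - D for every i, where D is
    a quarter of the squared distance between z and z'. A uniform decrease of the
    radius exists because s - r_i <= s: it turns the gain D in the squares into a
    gain of at least D / (2 s) in the distances. *)
Lemma encloses_midpoint z z' s :
  encloses c r z s -> encloses c r z' s -> z != z' ->
  exists2 s', s' < s & encloses c r (2^-1 *: (z + z')) s'.
Proof.
move=> /enclosesP le_z /enclosesP le_z' zz'.
set D := norm2 (z - z') ^+ 2 / 4.
have D0 : 0 < D.
  by rewrite divr_gt0 // exprn_gt0 // lt0r norm2_ge0 norm2_eq0 subr_eq0 zz'.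
have le_w i : norm2 (c i - 2^-1 *: (z + z')) ^+ 2 <= (s - r i) ^+ 2 - D.
  have -> : c i - 2^-1 *: (z + z') = 2^-1 *: ((c i - z) + (c i - z')).
    by apply/rowP => j; rewrite !mxE; field.
  rewrite parallelogram_midpoint.
  have -> : c i - z - (c i - z') = (- 1) *: (z - z').
    by apply/rowP => j; rewrite !mxE; ring.
  rewrite norm2Z normrN1 mul1r -/D.
  have := le_z i; have := le_z' i.
  have := norm2_ge0 (c i - z); have := norm2_ge0 (c i - z').
  move: (norm2 _) (norm2 _) => p q p0 q0 ps qs.
  have : p ^+ 2 <= (s - r i) ^+ 2 by rewrite ler_sqr ?nnegrE; lra.
  have : q ^+ 2 <= (s - r i) ^+ 2 by rewrite ler_sqr ?nnegrE; lra.
  lra.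
have sr_ge0 i : 0 <= s - r i by have := le_z i; have := norm2_ge0 (c i - z); lra.
have le_D i : D <= (s - r i) ^+ 2.
  by rewrite -subr_ge0; apply: le_trans (le_w i); apply: sqr_ge0.
have s_gt0 : 0 < s.
  have := le_D (Ordinal m_gt0); have := sr_ge0 (Ordinal m_gt0).
  have := r_ge0 (Ordinal m_gt0); nra.
set e := D / (2 * s).
have eE : D = 2 * s * e by rewrite /e mulrC divfK // gt_eqF // mulr_gt0.
have e0 : 0 < e by rewrite divr_gt0 // mulr_gt0.
exists (s - e); first by lra.
apply/enclosesP => i; rewrite -lerBrDr.
have := le_D i; have := sr_ge0 i; have := r_ge0 i; have := le_w i.
move=> lew ri0 sri leD.
have se : 0 <= s - e - r i by nra.
rewrite -(ler_pXn2r (n := 2)) ?nnegrE ?norm2_ge0 //.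
apply: le_trans lew _; nra.
Qed.

Lemma smallest_enclosing_ball_unique z z' s s' :
  smallest_enclosing_ball c r z s -> smallest_enclosing_ball c r z' s' ->
  z = z' /\ s = s'.
Proof.
move=> [enc_z min_s] [enc_z' min_s'].
have ss' : s = s' by apply/le_anti; rewrite (min_s _ _ enc_z') (min_s' _ _ enc_z).
split=> //; apply/eqP; apply: contraT => zz'.
move: enc_z'; rewrite -ss' => enc_z'.
have [t ts enc_w] := encloses_midpoint enc_z enc_z' zz'.
by have := min_s _ _ enc_w; rewrite leNgt ts.
Qed.

Lemma InfQ_optimal_smallest (x : 'rV[R]_(1 + d)) :
  InfQ_optimal [set pt (- r i) (c i) | i in [set: 'I_m]] x ->
  smallest_enclosing_ball c r (pt_bar x) (- pt_head x).
Proof.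
move=> [feas_x max_x]; split; first exact/encloses_feasible.
move=> z s enc_z.
have headE : pt_head (pt (- s) z) = - s by rewrite /pt_head row_mxKl mxE.
have barE : pt_bar (pt (- s) z) = z by rewrite /pt_bar row_mxKr.
rewrite lerNl -headE; apply/max_x/encloses_feasible.
by rewrite headE barE opprK.
Qed.

End EnclosingBalls.

Theorem mainTheorem1 (R : realType) (n : nat) (hn : (2 <= n)%N)
    (m : nat) (hm : (1 <= m)%N)
    (c : 'I_m -> 'rV[R]_(n.-1)) (r : 'I_m -> R) (hr : forall i, 0 <= r i)
    (x : 'rV[R]_(1 + n.-1))
    (hx : InfQ_optimal [set pt (- r i) (c i) | i in [set: 'I_m]] x) :
  smallest_enclosing_ball c r (pt_bar x) (- pt_head x) /\
  (forall (z : 'rV[R]_(n.-1)) (s : R),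
     smallest_enclosing_ball c r z s -> z = pt_bar x /\ s = - pt_head x).
Proof.
have d_gt0 : (0 < n.-1)%N by rewrite -ltnS prednK // (ltn_trans _ hn).
have small_x := InfQ_optimal_smallest d_gt0 hm hr hx.
split=> // z s small_z.
exact: (smallest_enclosing_ball_unique d_gt0 hm hr small_z small_x).
Qed.
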